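(* Let $f$ be an invariant algebraic curve of a polynomial vector field $X$ of degree $d$ on $\mathbb{C}^2$. If the geometric multiplicity satisfies $\mu_g(X,f)>1$, then the integrable multiplicity satisfies $\mu_i(X,f)>1$.
   Context: A polynomial vector field of degree $d$ on $\mathbb{C}^2$ is $X=a\,\frac{\partial}{\partial x}+b\,\frac{\partial}{\partial y}$ with $a,b\in\mathbb{C}[x,y]$ and $\max(\deg a,\deg b)=d$; it acts by $X(f)=a f_x+b f_y$. An algebraic curve $\{f=0\}$ (or simply $f$), $f\in\mathbb{C}[x,y]$, is invariant by $X$ if $X(f)/f$ is a polynomial. Geometric multiplicity: $f$ has $l$-geometric multiplicity $\mu_{g,l}(X,f)=m$ if $m$ is the largest number (possibly $+\infty$) for which there exists a sequence of vector fields $X_k$ of degree $d$ converging to $X$ such that each $X_k$ has $m$ distinct invariant algebraic curves $f_k^{(1)},\ldots,f_k^{(m)}$ of degree at most $l$, all converging to $f$ as $k\to\infty$. Distinct means that pairwise they have no common factors; convergence means convergence of the coefficients of the polynomials involved. The geometric multiplicity is $\mu_g(X,f)=\lim_{l\to\infty}\mu_{g,l}(X,f)$ (possibly $+\infty$). Integrable multiplicity: for $f,g\in\mathbb{C}[x,y]$, $e=\exp(g/f)$ is an exponential factor of $X$ if $X(e)/e$ is a polynomial of degree at most $d-1$; then $g/f$ is called an exponential coefficient of $X$. $\mathcal{C}_{exp}(f)$ is the $\mathbb{C}$-vector subspace of the rational functions on $\mathbb{C}^2$ formed by all exponential coefficients of $X$ of the form $g/f^k$, with $g\in\mathbb{C}[x,y]$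 and $k$ a non-negative integer. The integrable multiplicity $\mu_i(X,f)$ is $m$ if $\dim_{\mathbb{C}}\mathcal{C}_{exp}(f)=m-1$. *)

(* Defs.v *)
From HB Require Import structures.
From mathcomp Require Import all_boot all_order all_algebra.
From mathcomp Require Import mpoly complex.
From mathcomp Require Import classical_sets reals ereal topology normedtype.
From mathcomp Require Import sequences ring.

(* C is R[i] for an arbitrary R : realType and C[x,y] is {mpoly R[i][2]}, with
   x, y the variables of index 0, 1.  [msize p] is deg p + 1, and 0 for p = 0;
   the zero polynomial thus has degree -oo and "deg p <= d - 1" reads
   [msize p <= d], also when d = 0. *)

Set Implicit Arguments.
Unset Strict Implicit.
Unset Printing Implicit Defensive.

Import Order.TTheory GRing.Theory Num.Theory.
Import numFieldNormedType.Exports.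

Local Open Scope classical_set_scope.
Local Open Scope ring_scope.

Local Notation "x %:F" := (@FracField.tofrac _ x).

Notation poly2 R := {mpoly (complex R)[2]}.
Notation ratfun2 R := {fraction {mpoly (complex R)[2]}}.

(* (a, b) stands for a d/dx + b d/dy. *)
Notation vfield R := ({mpoly (complex R)[2]} * {mpoly (complex R)[2]})%type.

Definition vf_degree (R : realType) (d : nat) (X : vfield R) : Prop :=
  maxn (msize X.1) (msize X.2) = d.+1.

Definition vf_app (R : realType) (X : vfield R) (f : poly2 R) : poly2 R :=
  X.1 * mderiv ord0 f + X.2 * mderiv ord_max f.

(* Extension of the derivation to rational functions by the quotient rule; it is
   computed on the representative chosen by [repr], see [vf_rat_frac]. *)
Definition vf_rat (R : realType) (X : vfield R) (h : ratfun2 R) : ratfun2 R :=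
  let n := \n_(repr h) in let q := \d_(repr h) in
  (vf_app X n * q - n * vf_app X q)%:F / (q ^+ 2)%:F.

Definition inv_curve (R : realType) (X : vfield R) (f : poly2 R) : Prop :=
  (1 < msize f)%N /\ exists K : poly2 R, vf_app X f = K * f.

Definition no_common_factor (R : realType) (p q : poly2 R) : Prop :=
  forall h u v : poly2 R, p = u * h -> q = v * h -> (msize h <= 1)%N.

(* The numFieldType cast selects the topology given by the modulus on C. *)
Definition coef_cvg (R : realType) (p : nat -> poly2 R) (q : poly2 R) : Prop :=
  forall m : 'X_{1..2},
    (fun k => mcoeff m (p k) : (complex R : numFieldType)) @ \oo
      --> (mcoeff m q : (complex R : numFieldType)).

Definition vf_cvg (R : realType) (Xs : nat -> vfield R) (X : vfield R) : Prop :=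
  coef_cvg (fun k => (Xs k).1) X.1 /\ coef_cvg (fun k => (Xs k).2) X.2.

Definition approx_by_curves (R : realType) (d l : nat) (X : vfield R)
    (f : poly2 R) (m : nat) : Prop :=
  exists (Xs : nat -> vfield R) (fs : nat -> 'I_m -> poly2 R),
    [/\ forall k, vf_degree d (Xs k),
        vf_cvg Xs X,
        forall k i, inv_curve (Xs k) (fs k i) /\ (msize (fs k i) <= l.+1)%N,
        forall k i j, i != j -> no_common_factor (fs k i) (fs k j)
      & forall i, coef_cvg (fs^~ i) f].

Definition mu_gl (R : realType) (d l : nat) (X : vfield R) (f : poly2 R) :
    \bar R :=
  ereal_sup [set (m%:R)%:E | m in [set m | approx_by_curves d l X f m]].

Definition mu_g (R : realType) (d : nat) (X : vfield R) (f : poly2 R) :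
    \bar R :=
  lim (mu_gl d l X f @[l --> \oo]).

(* The exponential e = exp h satisfies X(e)/e = X(h). *)
Definition exp_coef (R : realType) (d : nat) (X : vfield R) (h : ratfun2 R) :
    Prop :=
  exists2 L : poly2 R, vf_rat X h = L%:F & (msize L <= d)%N.

Definition Cexp (R : realType) (d : nat) (X : vfield R) (f : poly2 R) :
    set (ratfun2 R) :=
  [set h | exp_coef d X h
         /\ exists (g : poly2 R) (k : nat), h = g%:F / f%:F ^+ k].

Definition cst_rat (R : realType) (c : complex R) : ratfun2 R := c%:MP%:F.

Definition free_mod_cst (R : realType) (n : nat) (h : 'I_n -> ratfun2 R) :
    Prop :=
  forall (c : 'I_n -> complex R) (c0 : complex R),
    \sum_(i < n) cst_rat (c i) * h i = cst_rat c0 -> forall i, c i = 0.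

(* Dimension over C, modulo the constants, of a subspace of C(x,y). *)
Definition dim_mod_cst (R : realType) (W : set (ratfun2 R)) : \bar R :=
  ereal_sup [set (n%:R)%:E | n in
    [set n | exists h : 'I_n -> ratfun2 R,
       (forall i, W (h i)) /\ free_mod_cst h]].

(* Constants always lie in [Cexp] (take g = c f^k) and correspond to the trivial
   factors exp c; were they counted, mu_i would be at least 2 for every curve
   and could never equal 1.  They are therefore quotiented out. *)
Definition mu_i (R : realType) (d : nat) (X : vfield R) (f : poly2 R) :
    \bar R :=
  (1 + dim_mod_cst (Cexp d X f))%E.

Lemma tofrac_div_eq (D : idomainType) (a b c d : D) : b != 0 -> d != 0 ->
  (a%:F / b%:F == c%:F / d%:F) = (a * d == c * b).
Proof.
by move=> b0 d0; rewrite eqr_div ?tofrac_eq0// -!tofracM tofrac_eq.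
Qed.

Lemma tofrac_repr (D : idomainType) (h : {fraction D}) :
  h = (\n_(repr h))%:F / (\d_(repr h))%:F.
Proof.
rewrite -[h in LHS]reprK; move: (repr h) => r.
rewrite -[r in LHS]Ratio_numden; unlock FracField.tofrac.
rewrite -[X in _ = _ * X]FracField.pi_inv -[RHS]FracField.pi_mul.
rewrite /FracField.mulf /FracField.invf.
by rewrite !numden_Ratio ?mulr1 ?mul1r ?oner_neq0 ?denom_ratioP.
Qed.

Lemma quotient_rule_wd (D : comNzRingType) (n e p q n' e' p' q' : D) :
  p * e = n * q -> p' * e + p * e' = n' * q + n * q' ->
  (n' * e - n * e') * q ^+ 2 = (p' * q - p * q') * e ^+ 2.
Proof.
move=> pe Xpe; apply/esym/subr0_eq.
have -> : (p' * q - p * q') * e ^+ 2 - (n' * e - n * e') * q ^+ 2 =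
    q * e * (p' * e + p * e' - (n' * q + n * q'))
    - (q' * e + q * e') * (p * e - n * q) by ring.
by rewrite Xpe pe !subrr !mulr0 subrr.
Qed.

Lemma vf_appM (R : realType) (X : vfield R) (p q : poly2 R) :
  vf_app X (p * q) = vf_app X p * q + p * vf_app X q.
Proof.
rewrite /vf_app !mderivM !mulrDr !mulrDl !mulrA [p * X.1]mulrC [p * X.2]mulrC.
by rewrite addrACA.
Qed.

Lemma vf_rat_frac (R : realType) (X : vfield R) (p q : poly2 R) : q != 0 ->
  vf_rat X (p%:F / q%:F) = (vf_app X p * q - p * vf_app X q)%:F / (q ^+ 2)%:F.
Proof.
move=> q0; rewrite /vf_rat; set h := p%:F / q%:F; cbv zeta.
have hE := tofrac_repr h; move: hE (denom_ratioP (repr h)).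
move: (\n_(repr h)) (\d_(repr h)) => n e /eqP; rewrite /h => hE e0.
have pe : p * e = n * q by apply/eqP; rewrite -tofrac_div_eq.
apply/eqP; rewrite tofrac_div_eq ?expf_neq0//; apply/eqP.
apply: (quotient_rule_wd pe); by rewrite -!vf_appM pe.
Qed.

(* Main.v *)
Require Import Defs.
From mathcomp Require Import all_boot all_order all_algebra.
From mathcomp Require Import mpoly complex.
From mathcomp Require Import boolp classical_sets reals ereal.
From mathcomp Require Import topology normedtype sequences ring.

(** Let F_k and G_k be invariant curves of X_k, without common factor, both
    converging to f, while X_k converges to X.  With cofactors K_k and H_k,
    the quotient F_k / G_k satisfies X_k(F_k / G_k) = (K_k - H_k) F_k / G_k.
    Fix a monomial m0 whose coefficient in f is not zero and take the
    combination g of F_k and G_k, with constant coefficients, in which m0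
    cancels.  Then
<<
      X_k(g) G_k - g X_k(G_k) = L F_k G_k
>>
    where L is a constant multiple of K_k - H_k, hence of degree at most
    d - 1, and g is not zero, because F_k and G_k are not proportional
    ([invariant_pair_sol]).

    For fixed k this equation, together with the vanishing of g at m0, is a
    homogeneous linear system in the coefficients of (g, L), whose number of
    unknowns does not depend on k and whose matrix converges with k.  Being
    injective is an open condition on matrices ([near_row_free]), so the
    limit system also has a nonzero solution: a pair (g, L) with
<<
      X(g) f - g X(f) = L f^2,
>>
    that is, X(g / f) = L ([nontrivial_sol_limit]).  If g were zero then so
    would be L; hence g is not zero.  It does not contain m0, which f
    contains, so g / f is not constant, and it is a nontrivial exponential
    coefficient of X. *)

Set Implicit Arguments.
Unset Strict Implicit.
Unset Printing Implicit Defensive.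

Import Order.TTheory GRing.Theory Num.Theory.
Import numFieldNormedType.Exports.

Local Open Scope classical_set_scope.
Local Open Scope ring_scope.

Local Notation "x %:F" := (@FracField.tofrac _ x).

(** * Injectivity of a matrix persists under small perturbations *)

Section MatrixLimit.
Variables (K : numFieldType) (m n : nat).
Variables (A_ : nat -> 'M[K]_(m, n)) (A : 'M[K]_(m, n)).
Hypothesis A_A : forall i j, A_ k i j @[k --> \oo] --> A i j.

Lemma det_mulmx_cvg (B : 'M[K]_(n, m)) :
  \det (A_ k *m B) @[k --> \oo] --> \det (A *m B).
Proof.
apply: cvg_big => [|s _]; first exact: add_continuous.
apply: cvgM; first exact: cvg_cst.
apply: cvg_big => [|i _]; first exact: mul_continuous.
rewrite mxE; under eq_cvg do rewrite mxE.
apply: cvg_big => [|j _]; first exact: add_continuous.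
by apply: cvgM; [exact: A_A|exact: cvg_cst].
Qed.

(** A right inverse B of A makes the determinant of [A_ k *m B] tend to 1, so
    this square matrix is eventually invertible. *)
Lemma near_row_free : row_free A -> \forall k \near \oo, row_free (A_ k).
Proof.
case/row_freeP => B AB1; have := @det_mulmx_cvg B.
rewrite AB1 det1 => /cvgr_neq0 /(_ (oner_neq0 _)).
apply: filterS => k dk; apply/row_freeP.
exists (B *m invmx (A_ k *m B)); rewrite mulmxA mulmxV //.
by rewrite unitmxE unitfE.
Qed.

End MatrixLimit.

(** * Limits of polynomials, coefficient by coefficient *)

Section CoefficientLimit.
Variable R : realType.
Implicit Types (p q : nat -> poly2 R) (P Q : poly2 R).

Lemma coef_cvg_cst P : coef_cvg (fun=> P) P.
Proof. by move=> m; exact: cvg_cst. Qed.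

Lemma coef_cvgD p q P Q :
  coef_cvg p P -> coef_cvg q Q -> coef_cvg (fun k => p k + q k) (P + Q).
Proof.
move=> pP qQ m; rewrite mcoeffD; under eq_cvg do rewrite mcoeffD.
by apply: cvgD; [exact: pP|exact: qQ].
Qed.

Lemma coef_cvgN p P : coef_cvg p P -> coef_cvg (fun k => - p k) (- P).
Proof.
move=> pP m; rewrite mcoeffN; under eq_cvg do rewrite mcoeffN.
by apply: cvgN; exact: pP.
Qed.

Lemma coef_cvgM p q P Q :
  coef_cvg p P -> coef_cvg q Q -> coef_cvg (fun k => p k * q k) (P * Q).
Proof.
move=> pP qQ m; rewrite mcoeffM; under eq_cvg do rewrite mcoeffM.
apply: cvg_big => [|j _]; first exact: add_continuous.
by apply: cvgM; [exact: pP|exact: qQ].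
Qed.

Lemma coef_cvg_mderiv i p P :
  coef_cvg p P -> coef_cvg (fun k => mderiv i (p k)) (mderiv i P).
Proof.
move=> pP m; rewrite mcoeff_deriv; under eq_cvg do rewrite mcoeff_deriv.
by apply: cvgMn; exact: pP.
Qed.

Lemma coef_cvg_vf_app (Xs : nat -> vfield R) X p P :
  vf_cvg Xs X -> coef_cvg p P ->
  coef_cvg (fun k => vf_app (Xs k) (p k)) (vf_app X P).
Proof.
case=> X1 X2 pP; have dP i := coef_cvg_mderiv (i := i) pP.
exact (coef_cvgD (coef_cvgM X1 (dP ord0)) (coef_cvgM X2 (dP ord_max))).
Qed.

(** The coefficients of the limits below a degree N that bounds them all form
    a matrix with finitely many columns.  The degrees of the approximating
    polynomials may be unbounded: truncating them keeps their dependences. *)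
Lemma lin_dep_limit (J : finType) (p : nat -> J -> poly2 R)
    (P : J -> poly2 R) :
  (forall j, coef_cvg (p^~ j) (P j)) ->
  (\forall k \near \oo, exists2 c : J -> complex R,
      \sum_j c j *: p k j = 0 & exists j, c j != 0) ->
  exists2 c : J -> complex R, \sum_j c j *: P j = 0 & exists j, c j != 0.
Proof.
move=> pP dep; pose N := (\max_j msize (P j))%N.
pose M (q : J -> poly2 R) :
    'M[complex R : numFieldType]_(#|J|, #|{: 'X_{1..2 < N}}|) :=
  \matrix_(i, t) (q (enum_val i))@_(enum_val t : 'X_{1..2 < N}).
have MP i t : M (p k) i t @[k --> \oo] --> M P i t.
  by rewrite mxE; under eq_cvg do rewrite mxE; exact: pP.
have [/(near_row_free MP) free|] := boolP (row_free (M P)).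
  (* a dependence at a single index k contradicts the independence there *)
  have [k [freek [c c0 [j cj]]]] := filter_ex (filterI free dep).
  move/negP: cj; case; apply/eqP.
  have cM : \row_i c (enum_val i) *m M (p k) = 0.
    apply/rowP => t; rewrite !mxE.
    have /(congr1 (mcoeff (enum_val t : 'X_{1..2 < N}))) := c0.
    rewrite mcoeff0 raddf_sum /= (reindex _ (onW_bij _ (@enum_val_bij J))).
    by apply: etrans; apply: eq_bigr => i _; rewrite !mxE mcoeffZ.
  have := row_free_inj freek (etrans cM (esym (mul0mx _ _))).
  by move/rowP/(_ (enum_rank j)); rewrite !mxE enum_rankK.
rewrite -kermx_eq0 => /rowV0Pn[u /sub_kermxP uM u0].
exists (fun j => u 0 (enum_rank j)).
  apply/mpolyP => t; rewrite mcoeff0 raddf_sum /=.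
  have [tN|tN] := ltnP (mdeg t) N; last first.
    apply: big1 => j _; rewrite mcoeffZ (memN_msupp_eq0 (m := t)) ?mulr0 //.
    apply/msize_mdeg_ge/(leq_trans _ tN).
    exact: (leq_bigmax (F := fun j => msize (P j))).
  move/rowP/(_ (enum_rank (BMultinom tN))): uM; rewrite !mxE; apply: etrans.
  rewrite (reindex _ (onW_bij _ (@enum_val_bij J))); apply: eq_bigr => i _.
  by rewrite mcoeffZ !mxE enum_valK enum_rankK.
have /rV0Pn[i ui] := u0.
by exists (enum_val i); rewrite enum_valK.
Qed.

End CoefficientLimit.
Arguments coef_cvg_cst {R} P m.

(** * Cofactors and exponential coefficients *)

Section Derivation.
Variables (R : realType) (X : vfield R).
Implicit Types (f g K L : poly2 R).

Lemma vf_app0 : vf_app X 0 = 0.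
Proof. by rewrite /vf_app !mderiv0 !mulr0 addr0. Qed.

Lemma vf_app_is_linear : linear (vf_app X).
Proof.
move=> c f g; rewrite /vf_app !mderivD !mderivZ !mulrDr -!scalerAr scalerDr.
by rewrite addrACA.
Qed.

Lemma vf_app_sum (I : finType) (c : I -> complex R) (g : I -> poly2 R) :
  vf_app X (\sum_i c i *: g i) = \sum_i c i *: vf_app X (g i).
Proof.
apply: (big_ind2 (fun u v => vf_app X u = v)) => [|u ? v ? <- <-|i _].
- exact: vf_app0.
- by have := vf_app_is_linear 1 u v; rewrite !scale1r.
by have := vf_app_is_linear (c i) (g i) 0; rewrite vf_app0 !addr0.
Qed.

Lemma msize_mderiv i f : f != 0 -> (msize (mderiv i f) < msize f)%N.
Proof.
move=> f0; have [->|df0] := eqVneq (mderiv i f) 0.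
  by rewrite msize0 lt0n msize_poly_eq0.
rewrite -(mlead_deg df0); have := mlead_supp df0.
rewrite mcoeff_msupp mcoeff_deriv => dfm.
have : f@_(mlead (mderiv i f) + U_(i)) != 0.
  by apply: contraNneq dfm => ->; rewrite mul0rn.
by rewrite -mcoeff_msupp => /msize_mdeg_lt; rewrite mdegD mdeg1 addn1.
Qed.

(** Applying X to f raises the degree by at most d - 1. *)
Lemma msize_cofactor d f K :
  vf_degree d X -> f != 0 -> vf_app X f = K * f -> (msize K <= d)%N.
Proof.
move=> Xd f0 XK; have [->|K0] := eqVneq K 0; first by rewrite msize0.
have bound a i : (msize a <= d.+1)%N ->
    (msize (a * mderiv i f) <= d + (msize f).-1)%N.
  move=> ad; have [->|a0] := eqVneq a 0; first by rewrite mul0r msize0.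
  have [->|df0] := eqVneq (mderiv i f) 0; first by rewrite mulr0 msize0.
  rewrite msizeM //; have := msize_mderiv i f0.
  case: (msize f) => // n; rewrite ltnS /= => dfn.
  rewrite -ltnS prednK ?addn_gt0 ?lt0n ?msize_poly_eq0 ?a0 //.
  by rewrite -addSn leq_add.
have : (msize (vf_app X f) <= d + (msize f).-1)%N.
  apply: leq_trans (msizeD_le _ _) _; rewrite geq_max.
  move: (leqnn d.+1); rewrite -{1}Xd geq_max => /andP[X1 X2].
  by apply/andP; split; [exact: bound X1|exact: bound X2].
rewrite XK msizeM //; have : (0 < msize f)%N by rewrite lt0n msize_poly_eq0.
by case: (msize f) => // n _; rewrite addnS /= leq_add2r.
Qed.

(** By the quotient rule, the equation says that X(g / f) = L. *)
Lemma exp_coef_frac d f g L : f != 0 -> (msize L <= d)%N ->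
  vf_app X g * f - g * vf_app X f = L * (f * f) -> exp_coef d X (g%:F / f%:F).
Proof.
move=> f0 Ld E; exists L => //; rewrite vf_rat_frac // E expr2 tofracM mulfK //.
by rewrite tofrac_eq0 mulf_neq0.
Qed.

End Derivation.

(** * Linear combinations of distinct monomials *)

Section MonomialSums.
Variables (R : realType) (I : finType) (e : I -> 'X_{1..2}).
Implicit Type c : I -> complex R.

Lemma mcoeff_monomial_sum c j : injective e ->
  (\sum_i c i *: 'X_[e i] : poly2 R)@_(e j) = c j.
Proof.
move=> inj_e; rewrite raddf_sum (bigD1 j) //= mcoeffZ mcoeffX eqxx mulr1.
rewrite big1 ?addr0 // => i ij.
by rewrite mcoeffZ mcoeffX (inj_eq inj_e) (negPf ij) mulr0.
Qed.

Lemma mcoeff_monomial_sum0 c m : (forall i, e i != m) ->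
  (\sum_i c i *: 'X_[e i] : poly2 R)@_m = 0.
Proof.
move=> em; rewrite raddf_sum big1 // => i _.
by rewrite /= mcoeffZ mcoeffX (negPf (em i)) mulr0.
Qed.

Lemma msize_monomial_sum c n : (forall i, mdeg (e i) < n)%N ->
  (msize (\sum_i c i *: 'X_[e i] : poly2 R) <= n)%N.
Proof.
move=> en; apply: (big_ind (fun P : poly2 R => msize P <= n)%N).
- by rewrite msize0.
- by move=> P Q Pn Qn; rewrite (leq_trans (msizeD_le _ _)) // geq_max Pn.
by move=> i _; rewrite (leq_trans (msizeZ_le _ _)) // msizeX.
Qed.

End MonomialSums.

(** * The linear system satisfied by quotients of invariant curves *)

Section QuotientEquation.
Variables (R : realType) (l d : nat) (m0 : 'X_{1..2}).

(** For F = G this says that X(g / G) = L.  Allowing two curves keeps the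
    equation exact before the limit, where F and G still differ. *)
Definition quot_eq (X : vfield R) (F G g L : poly2 R) : Prop :=
  vf_app X g * G - g * vf_app X G = L * (F * G).

Let A : {pred 'X_{1..2 < l.+1}} := [pred m | bmnm m != m0].

Let J : finType := ({m in A} + 'X_{1..2 < d})%type.

(** The images of the basis vectors of the space of pairs (g, L) under the
    linear map whose kernel is [quot_eq X F G]; the monomials of g range over
    degrees at most l without m0, those of L over degrees at most d - 1. *)
Definition quot_eq_gen (X : vfield R) (F G : poly2 R) (j : J) : poly2 R :=
  match j with
  | inl m => vf_app X 'X_[val m] * G - 'X_[val m] * vf_app X G
  | inr m => - ('X_[val m] * (F * G))
  end.

Definition numerator_of (c : J -> complex R) : poly2 R :=
  \sum_(m : {m in A}) c (inl m) *: 'X_[val m].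

Definition cofactor_of (c : J -> complex R) : poly2 R :=
  \sum_(m : 'X_{1..2 < d}) c (inr m) *: 'X_[val m].

Lemma quot_eq_genP X F G c :
  \sum_j c j *: quot_eq_gen X F G j = 0 <->
  quot_eq X F G (numerator_of c) (cofactor_of c).
Proof.
have -> : \sum_j c j *: quot_eq_gen X F G j =
    vf_app X (numerator_of c) * G - numerator_of c * vf_app X G
    - cofactor_of c * (F * G).
  rewrite big_sumType /= vf_app_sum !mulr_suml -!sumrB -sumrN; congr (_ + _).
    by apply: eq_bigr => m _; rewrite scalerBr !scalerAl.
  by apply: eq_bigr => m _; rewrite scalerN scalerAl.
by split=> [/subr0_eq//|E]; rewrite E subrr.
Qed.

Lemma quot_eq_gen_cvg (Xs : nat -> vfield R) (Fs Gs : nat -> poly2 R) X F G j :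
  vf_cvg Xs X -> coef_cvg Fs F -> coef_cvg Gs G ->
  coef_cvg (fun k => quot_eq_gen (Xs k) (Fs k) (Gs k) j) (quot_eq_gen X F G j).
Proof.
move=> XsX FsF GsG; case: j => m.
  have cvgm := coef_cvg_cst ('X_[val m] : poly2 R).
  exact (coef_cvgD (coef_cvgM (coef_cvg_vf_app XsX cvgm) GsG)
    (coef_cvgN (coef_cvgM cvgm (coef_cvg_vf_app XsX GsG)))).
exact (coef_cvgN (coef_cvgM (coef_cvg_cst _) (coef_cvgM FsF GsG))).
Qed.

(** The vanishing of g at m0 excludes the solutions g = c G, L = 0, which
    always exist and whose limits are the constants g / f. *)
Definition nontrivial_sol X F G (g L : poly2 R) : Prop :=
  [/\ g != 0, g@_m0 = 0, (msize L <= d)%N & quot_eq X F G g L].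

(** The bound on the degree of g fixes the number of unknowns, so that
    [lin_dep_limit] applies to the systems of all indices k at once. *)
Lemma nontrivial_sol_limit (Xs : nat -> vfield R) (Fs Gs : nat -> poly2 R) X f :
  vf_cvg Xs X -> coef_cvg Fs f -> coef_cvg Gs f -> f != 0 ->
  (\forall k \near \oo, exists g L, (msize g <= l.+1)%N /\
    nontrivial_sol (Xs k) (Fs k) (Gs k) g L) ->
  exists g L, nontrivial_sol X f f g L.
Proof.
move=> XsX FsF GsG f0 sol.
have [c /quot_eq_genP E cn0] : exists2 c : J -> complex R,
    \sum_j c j *: quot_eq_gen X f f j = 0 & exists j, c j != 0.
  apply: (lin_dep_limit (fun j => quot_eq_gen_cvg (j := j) XsX FsF GsG)).
  apply: (filterS _ sol) => k [g [L [gl [g0 gm0 Ld E]]]].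
  pose c (j : J) := match j with inl m => g@_(val m) | inr m => L@_(val m) end.
  have gE : numerator_of c = g.
    rewrite [RHS](mpolywE gl) (bigID (mem A)) /= big_sub.
    rewrite [X in _ = _ + X]big1 ?addr0 // => m.
    by rewrite negbK => /eqP ->; rewrite gm0 scale0r.
  have LE : cofactor_of c = L by rewrite [RHS](mpolywE Ld).
  exists c; first by apply/quot_eq_genP; rewrite gE LE.
  have gmn0 : g@_(mlead g) != 0 by rewrite mleadc_eq0.
  have ml : (mdeg (mlead g) < l.+1)%N by rewrite mlead_deg.
  have mA : BMultinom ml \in A.
    by rewrite inE; apply: contraNneq gmn0 => /= ->; rewrite gm0.
  by exists (inl (Sub (BMultinom ml) mA)).
exists (numerator_of c), (cofactor_of c).
have inj_val : injective (fun m : {m in A} => bmnm (val m)).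
  by move=> m n /= /val_inj /val_inj.
split=> //.
  (* if g = 0 the equation reduces to L f^2 = 0, and the whole vector c is 0 *)
- apply/eqP => g0; case: cn0 => j; apply/negP/negPn/eqP.
  have L0 : cofactor_of c = 0.
    move: E; rewrite /quot_eq g0 mul0r subr0.
    rewrite vf_app0 mul0r => /esym/eqP.
    by rewrite mulf_eq0 (negPf (mulf_neq0 f0 f0)) orbF => /eqP.
  case: j => m.
    transitivity (numerator_of c)@_(bmnm (val m)); last by rewrite g0 mcoeff0.
    exact/esym/(mcoeff_monomial_sum (c \o inl) m inj_val).
  transitivity (cofactor_of c)@_(bmnm m); last by rewrite L0 mcoeff0.
  exact/esym/(mcoeff_monomial_sum (c \o inr) m val_inj).
- by apply: mcoeff_monomial_sum0 => m; exact: (valP m).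
- by apply: msize_monomial_sum => m; exact: bmdeg.
Qed.

(** For g = G@_m0 F - F@_m0 G the terms in G cancel on the left-hand side, and
    what remains is G@_m0 (K - H) F G with K, H the cofactors of F and G. *)
Lemma invariant_pair_sol X F G :
  vf_degree d X -> inv_curve X F -> inv_curve X G -> no_common_factor F G ->
  (msize F <= l.+1)%N -> (msize G <= l.+1)%N -> F@_m0 != 0 -> G@_m0 != 0 ->
  exists g L, (msize g <= l.+1)%N /\ nontrivial_sol X F G g L.
Proof.
move=> Xd [F1 [K XF]] [G1 [H XG]] FG Fl Gl Fm Gm.
have F0 : F != 0 by apply: contraNneq Fm => ->; rewrite mcoeff0.
have G0 : G != 0 by apply: contraNneq Gm => ->; rewrite mcoeff0.
have msizeB P Q n : (msize P <= n)%N -> (msize Q <= n)%N ->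
    (msize (P - Q : poly2 R) <= n)%N.
  by move=> Pn Qn; rewrite (leq_trans (msizeD_le _ _)) // geq_max msizeN Pn.
exists (G@_m0 *: F - F@_m0 *: G), (G@_m0 *: (K - H)); split.
  by rewrite msizeB // (leq_trans (msizeZ_le _ _)).
split.
  (* if F and G were proportional, G would be a nonconstant common factor *)
- apply/eqP => /subr0_eq GF; have := FG G ((G@_m0)^-1 * F@_m0)%:MP 1.
  rewrite mul1r mul_mpolyC -scalerA -GF scalerA mulVf // scale1r.
  by move=> /(_ erefl erefl); rewrite leqNgt G1.
- by rewrite mcoeffB !mcoeffZ mulrC subrr.
- rewrite (leq_trans (msizeZ_le _ _)) // msizeB //.
    exact: msize_cofactor XF.
  exact: msize_cofactor XG.
have XB : vf_app X (G@_m0 *: F - F@_m0 *: G) =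
    G@_m0 *: vf_app X F - F@_m0 *: vf_app X G.
  by rewrite /vf_app !mderivB !mderivZ -!mul_mpolyC; ring.
rewrite /quot_eq XB XF XG -!mul_mpolyC; ring.
Qed.

End QuotientEquation.

(** * From multiplicities to curves and to exponential coefficients *)

(** The multiplicities [mu_gl] increase with the degree bound, so they
    converge, and their limit can exceed 1 only if one of them does. *)
Lemma mu_g_gt1_curves (R : realType) d (X : vfield R) f :
  (1 < mu_g d X f)%E -> exists l m, (1 < m)%N /\ approx_by_curves d l X f m.
Proof.
move=> mu1; apply: contrapT => no.
have le1 l : (mu_gl d l X f <= 1)%E.
  apply: ge_ereal_sup => _ [m apx <-]; rewrite lee_fin -[1]/(1%:R) ler_nat.
  by rewrite leqNgt; apply/negP => m1; apply: no; exists l, m.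
move: mu1; rewrite ltNge => /negP; apply; apply: lime_le.
  apply: ereal_nondecreasing_is_cvgn => a b ab; apply: ereal_sup_le.
  apply: image_subset => m [Xs [fs [h1 h2 h3 h4 h5]]]; exists Xs, fs.
  split=> // k i; have [? fa] := h3 k i; split=> //.
  exact: leq_trans fa _.
exact: nearW.
Qed.

Lemma mu_i_gt1 (R : realType) d (X : vfield R) f h :
  Cexp d X f h -> (forall c c0, cst_rat c * h = cst_rat c0 -> c = 0) ->
  (1 < mu_i d X f)%E.
Proof.
move=> Ch free; have : (1%:E <= dim_mod_cst (Cexp d X f))%E.
  apply: ereal_sup_ubound; exists 1%N => //; exists (fun=> h); split=> // c c0.
  by rewrite big_ord1 => /free c00 i; rewrite ord1.
move/(leeD2l 1%E); apply: lt_le_trans.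
by rewrite -EFinD lte_fin ltrDl ltr01.
Qed.

Theorem corollary2 (R : realType) (d : nat) (X : vfield R) (f : poly2 R) :
  vf_degree d X -> inv_curve X f ->
  (1 < mu_g d X f)%E -> (1 < mu_i d X f)%E.
Proof.
move=> Xd [f1 _] /mu_g_gt1_curves[l [m [m1 [Xs [fs [Xsd XsX inv ncf cvgf]]]]]].
have f0 : f != 0 by rewrite -msize_poly_eq0 -lt0n ltnW.
pose m0 := mlead f; have fm0 : f@_m0 != 0 by rewrite mleadc_eq0.
pose i0 : 'I_m := Ordinal (ltnW m1); pose i1 : 'I_m := Ordinal m1.
have [g [L [g0 gm0 Ld E]]] : exists g L, nontrivial_sol d m0 X f f g L.
  apply: (nontrivial_sol_limit (l := l) XsX (cvgf i0) (cvgf i1) f0).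
  have fsm0 i : \forall k \near \oo, (fs k i)@_m0 != 0.
    exact: cvgr_neq0 (cvgf i m0) fm0.
  apply: filterS2 (fsm0 i0) (fsm0 i1) => k Fm Gm.
  have [[invF Fl] [invG Gl]] := (inv k i0, inv k i1).
  exact: invariant_pair_sol (Xsd k) invF invG (ncf k i0 i1 isT) Fl Gl Fm Gm.
apply: (mu_i_gt1 (h := g%:F / f%:F)); first split.
- exact: exp_coef_frac E.
- by exists g, 1%N; rewrite expr1.
move=> c c0 cE; have {cE} : c *: g = c0 *: f.
  apply/eqP; rewrite -!mul_mpolyC -tofrac_eq !tofracM -[c0%:MP%:F]cE.
  by rewrite mulrA divfK // tofrac_eq0.
move=> E0; have c00 : c0 = 0.
  move/(congr1 (mcoeff m0)): E0; rewrite !mcoeffZ gm0 mulr0 => /esym/eqP.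
  by rewrite mulf_eq0 (negPf fm0) orbF => /eqP.
apply/eqP; move/eqP: E0; rewrite c00 scale0r.
by apply: contraTT => c1; rewrite scaler_eq0 negb_or c1.
Qed.
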